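(* For any positive integer $m$, the set of positive integers $n$ such that $m\mid v_n$ has asymptotic density one; that is, $\lim_{x\to\infty} \frac1x\,|\{n\in\mathbb{Z} : 1\le n\le x,\ m\mid v_n\}| = 1$.
   Context: For a positive integer $n$, let $H_n = 1+\frac12+\frac13+\cdots+\frac1n$ be the $n$-th harmonic number, written in lowest terms as $H_n = u_n/v_n$ with $u_n, v_n$ integers, $\gcd(u_n,v_n)=1$ and $v_n>0$. *)

(* Defs.v *)
From HB Require Import structures.
From mathcomp Require Import all_boot all_order all_algebra finmap.
From mathcomp Require Import all_classical all_reals all_analysis.

Set Implicit Arguments.
Unset Strict Implicit.
Unset Printing Implicit Defensive.

Import Order.TTheory GRing.Theory Num.Theory.
Import numFieldNormedType.Exports.

Local Open Scope classical_set_scope.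
Local Open Scope ring_scope.

Definition harmonic_number (n : nat) : rat := \sum_(1 <= k < n.+1) k%:R^-1.

(* [denq] is the positive denominator of the reduced fraction. *)
Definition harmonic_den (n : nat) : int := denq (harmonic_number n).

Definition initial_part (R : realType) (A : set nat) (x : R) : set nat :=
  [set n : nat | [/\ (1 <= n)%N, n%:R <= x & A n]].

(* [fset_set] has the junk value [fset0] on infinite sets; this lemma shows
   that [counting_function] never uses it. *)
Lemma finite_initial_part (R : realType) (A : set nat) (x : R) :
  finite_set (initial_part A x).
Proof.
apply: (@sub_finite_set _ _ `I_(Num.truncn x).+1); last exact: finite_II.
move=> n [n1 nx _] /=; rewrite ltnS.
by rewrite truncn_ge_nat // (le_trans _ nx).
Qed.

Definition counting_function (R : realType) (A : set nat) (x : R) : nat :=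
  #|` fset_set (initial_part A x)|.

Definition has_asymptotic_density (R : realType) (A : set nat) (d : R) : Prop :=
  (fun x : R => (counting_function A x)%:R / x) @ +oo --> d.

(* Main.v *)
Require Import Defs.
From mathcomp Require Import all_boot all_order all_algebra finmap.
From mathcomp Require Import all_classical all_reals all_analysis.
From mathcomp Require Import zify ring lra.

(** The integer m divides the denominator v_n of H_n as soon as v_n is divisible
    by p ^ a for each prime p dividing m, where p ^ a is the exact power of p in
    m.  A finite union of sets of density zero has density zero, so it suffices
    to show that, for p prime, the set B_a of those n such that H_n has p-adic
    valuation greater than - a has density zero.

    Separating the terms with index divisible by p from the others gives
    H_n = H_(n %/ p) / p + (a p-adic integer).  Hence n %/ p belongs to B_a
    whenever n belongs to B_(a+1) [harmonic_val_gt_div], and by induction on a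
    everything reduces to B_0, the set of n such that p divides the numerator
    of H_n.

    The same relation shows that B_0 is stable by n |-> n %/ p.  Moreover p n and
    p n + 1 cannot both be in B_0, since H_(pn+1) - H_(pn) = 1 / (p n + 1) is a
    p-adic unit [harmonic_val_gt0_consecutive].  So each element of B_0 is the
    quotient by p of at most p - 1 elements of B_0, and B_0 has at most
    (p - 1) ^ k elements below p ^ k.  More generally it has at most
    (p - 1) ^ k M elements below p ^ k M, for all k and M, so its density is
    zero [negligible_harmonic_val_gt0]. *)

Import Order.TTheory GRing.Theory Num.Theory.
Import numFieldNormedType.Exports.

Local Open Scope classical_set_scope.
Local Open Scope ring_scope.

(** * The ideal generated by p in the rationals with denominator prime to p *)

(** For p prime, these are the rationals of positive p-adic valuation, together
    with 0: the maximal ideal of the localization of the integers at p. *)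
Definition num_multiple (p : nat) (q : rat) : bool := (p%:Z %| numq q)%Z.

(** Membership can be tested on any fraction z p / d, reduced or not, as long as
    its denominator d is prime to p; this makes the closure properties below
    plain computations with common denominators. *)
Lemma num_multipleP (p : nat) (q : rat) :
  reflect (exists (d : nat) (z : int),
             coprime p d /\ q * d%:R = p%:R * z%:~R)
          (num_multiple p q).
Proof.
apply: (iffP idP) => [pq | [d [z [cpd qdE]]]].
- exists `|denq q|%N, (numq q %/ p%:Z)%Z; split.
    apply: coprime_dvdl (coprime_num_den q).
    by move: pq; rewrite /num_multiple dvdzE.
  rewrite -[p%:R]/((p%:Z)%:~R) -intrM mulrC (mulrC p%:Z) divzK//.
  have -> : (`|denq q|%N)%:R = (denq q)%:~R :> rat.
    by rewrite -[LHS]/((`|denq q|%N%:Z)%:~R) gez0_abs.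
  by rewrite numqE mulrC.
(* Cross-multiplying gives numq q * d = p * z * denq q over the integers, and
   Gauss's lemma removes d. *)
- have /intr_inj eqz : (numq q * d%:Z)%:~R = (p%:Z * z * denq q)%:~R :> rat.
    rewrite !intrM numqE.
    rewrite -[(d%:Z)%:~R]/(d%:R : rat) -[(p%:Z)%:~R]/(p%:R : rat).
    by rewrite mulrAC qdE.
  have : (p %| `|numq q| * d)%N.
    have -> : (`|numq q| * d = p * `|(z * denq q)%R|)%N.
      by rewrite -[d in LHS]/(`|d%:Z|%N) -abszM eqz -mulrA abszM.
    exact: dvdn_mulr.
  by rewrite /num_multiple dvdzE Gauss_dvdl.
Qed.

Lemma num_multipleD p x y :
  num_multiple p x -> num_multiple p y -> num_multiple p (x + y).
Proof.
move=> /num_multipleP[d [z [cpd xE]]] /num_multipleP[d' [z' [cpd' yE]]].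
apply/num_multipleP; exists (d * d')%N, (z * d'%:Z + z' * d%:Z).
split; first by rewrite coprimeMr cpd.
rewrite natrM mulrDl mulrA xE (mulrC d%:R) mulrA yE intrD !intrM.
rewrite -[(d%:Z)%:~R]/(d%:R : rat) -[(d'%:Z)%:~R]/(d'%:R : rat).
by ring.
Qed.

Lemma num_multipleN p x : num_multiple p (- x) = num_multiple p x.
Proof. by rewrite /num_multiple numqN !dvdzE abszN. Qed.

Lemma num_multipleMl p (k : nat) x :
  num_multiple p x -> num_multiple p (k%:R * x).
Proof.
move=> /num_multipleP[d [z [cpd xE]]]; apply/num_multipleP.
exists d, (k%:Z * z); split => //.
by rewrite -mulrA xE intrM -[(k%:Z)%:~R]/(k%:R : rat) mulrCA.
Qed.

(** * The p-adic valuation of harmonic numbers *)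

Lemma harmonic_numberS n :
  harmonic_number n.+1 = harmonic_number n + n.+1%:R^-1.
Proof. by rewrite /harmonic_number big_nat_recr. Qed.

(** The terms of H_n with index divisible by p add up to H_(n %/ p) / p, and the
    other terms have denominators prime to p.  Hence p ^ (a+1) H_n and
    p ^ a H_(n %/ p) differ by p ^ (a+1) times a p-adic integer. *)
Lemma harmonic_number_div p a n : prime p ->
  num_multiple p ((p ^ a.+1)%:R * harmonic_number n
                  - (p ^ a)%:R * harmonic_number (n %/ p)).
Proof.
move=> pp; have p0 := prime_gt0 pp.
have pR : p%:R != 0 :> rat by rewrite pnatr_eq0 -lt0n.
elim: n => [|n IHn].
  by rewrite div0n /harmonic_number big_geq// !mulr0 subrr /num_multiple dvdz0.
rewrite divnS// harmonic_numberS.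
case: (boolP (p %| n.+1)%N) => [/dvdnP[k nE]|pn].
- have kE : (n %/ p).+1 = k.
    by have := divnS n p0; rewrite nE dvdn_mull// mulnK.
  rewrite add1n harmonic_numberS kE nE natrM.
  have kR : k%:R != 0 :> rat by rewrite -kE pnatr_eq0.
  rewrite [X in num_multiple p X](_ : _ =
    (p ^ a.+1)%:R * harmonic_number n - (p ^ a)%:R * harmonic_number (n %/ p))//.
  by rewrite !mulrDr expnS natrM; field; rewrite kR.
- rewrite add0n mulrDr addrAC; apply: num_multipleD => //.
  apply/num_multipleP; exists n.+1, (p ^ a)%:Z; split.
    by rewrite prime_coprime.
  by rewrite mulfVK ?pnatr_eq0// expnS natrM.
Qed.

(** For p prime: the p-adic valuation of the harmonic number H_n is greater
    than - a, or H_n = 0.  Writing the bound as - a keeps the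
    index natural, and for a = 0 the condition is that p divides the numerator
    of H_n. *)
Definition harmonic_val_gt (p a n : nat) : bool :=
  num_multiple p ((p ^ a)%:R * harmonic_number n).

Lemma harmonic_val_gt_div p a n : prime p ->
  harmonic_val_gt p a.+1 n -> harmonic_val_gt p a (n %/ p).
Proof.
move=> pp Bn.
have := num_multipleD p _ _ Bn _; rewrite /harmonic_val_gt => H.
have := harmonic_number_div p a n pp.
rewrite -num_multipleN => /H.
by rewrite opprB addrC subrK.
Qed.

(** At the level 0 the descent stays at the same level: if p divides the
    numerator of H_n, then the valuation of H_n is also greater than - 1. *)
Lemma harmonic_val_gt0_div p n : prime p ->
  harmonic_val_gt p 0 n -> harmonic_val_gt p 0 (n %/ p).
Proof.
move=> pp Bn; apply: harmonic_val_gt_div => //.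
rewrite /harmonic_val_gt expn1; move: Bn; rewrite /harmonic_val_gt expn0 mul1r.
exact: num_multipleMl.
Qed.

(** The two harmonic numbers differ by 1 / (p n + 1), which is a p-adic unit. *)
Lemma harmonic_val_gt0_consecutive p n : prime p ->
  harmonic_val_gt p 0 (p * n) -> ~~ harmonic_val_gt p 0 (p * n).+1.
Proof.
move=> pp B0; apply/negP => B1.
have : num_multiple p ((p * n).+1%:R^-1).
  move: B0 B1; rewrite /harmonic_val_gt expn0 !mul1r.
  rewrite harmonic_numberS -num_multipleN.
  by move=> B0 /(num_multipleD p _ _ B0); rewrite addKr.
move=> /num_multipleP[d [z [cpd dE]]].
have /intr_inj eqz : (d%:Z)%:~R = (p%:Z * z * ((p * n).+1)%:Z)%:~R :> rat.
  rewrite !intrM -[(d%:Z)%:~R]/(d%:R : rat) -[(p%:Z)%:~R]/(p%:R : rat).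
  rewrite -dE -[(((p * n).+1)%:Z)%:~R]/(((p * n).+1)%:R : rat).
  by rewrite mulrC mulrA divff ?mul1r// pnatr_eq0.
move: cpd; rewrite prime_coprime// => /negP; apply.
by rewrite -[d]/(`|d%:Z|%N) eqz -mulrA abszM dvdn_mulr.
Qed.

Lemma not_dvd_harmonic_den p a n : prime p ->
  ~~ (p ^ a %| `|harmonic_den n|)%N -> harmonic_val_gt p a n.
Proof.
move=> pp; rewrite /harmonic_den; set H := harmonic_number n => ndvd.
have vgt0 : (0 < `|denq H|)%N by rewrite absz_gt0 denq_neq0.
have [w cpw vE] := pfactor_coprime pp vgt0.
move: vE; set b := logn p _ => vE.
have ba : (b < a)%N by rewrite ltnNge -pfactor_dvdn.
(* The denominator is w * p ^ b with b < a, so p ^ a * H has denominator w and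
   at least one factor p left in its numerator. *)
apply/num_multipleP; exists w, ((p ^ (a - b.+1))%:Z * numq H); split => //.
have vR : (denq H)%:~R = w%:R * (p ^ b)%:R :> rat.
  by rewrite -natrM -vE -[RHS]/((`|denq H|%N%:Z)%:~R) gez0_abs.
rewrite -[a in LHS](subnKC ba) expnD expnS intrM numqE vR.
rewrite -[((p ^ (a - b.+1))%:Z)%:~R]/((p ^ (a - b.+1))%:R : rat) !natrM -/H.
by rewrite -!mulrA; congr (_ * _); rewrite mulrC -!mulrA.
Qed.

(** * Counting and sets of density zero *)

Definition count_below (B : pred nat) (N : nat) : nat := count B (iota 0 N).

Lemma count_below_le B N : (count_below B N <= N)%N.
Proof. by rewrite -[leqRHS](size_iota 0); exact: count_size. Qed.

Lemma count_below_mono B M N :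
  (M <= N)%N -> (count_below B M <= count_below B N)%N.
Proof.
by move=> /subnKC <-; rewrite /count_below iotaD count_cat leq_addr.
Qed.

(** The integers below p N are cut into the blocks of those with the same
    quotient by p. *)
Lemma count_below_blocks (B C : pred nat) p b N :
  (forall n, count B (iota (p * n) p) <= C n * b)%N ->
  (count_below B (p * N) <= b * count_below C N)%N.
Proof.
move=> BC; rewrite /count_below; elim: N => [|N IHN]; first by rewrite muln0.
rewrite mulnS addnC -addn1 !iotaD !count_cat !add0n mulnDr leq_add //.
by rewrite /= addn0 (mulnC b).
Qed.

Lemma count_block (B C : pred nat) p n : (forall k, B k -> C (k %/ p)%N) ->
  (count B (iota (p * n) p) <= C n * p)%N.
Proof.
move=> BC; case: (posnP p) => [->|p0] //.
case: (boolP (C n)) => [_|Cn].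
  by rewrite mul1n -[leqRHS](size_iota (p * n)); exact: count_size.
rewrite leqn0; apply/negPn; rewrite -lt0n -has_count -all_predC.
apply/allP => k; rewrite mem_iota => /andP[lek ltk] /=; apply: contra Cn => /BC.
suff -> : (k %/ p)%N = n by [].
apply/eqP; rewrite eqn_leq -ltnS ltn_divLR// leq_divRL//.
by rewrite mulSn (mulnC n) lek andbT addnC.
Qed.

(** Omitting one element from each block is what makes the density decay
    geometrically when B = C. *)
Lemma count_block_omit (B C : pred nat) p n : (1 < p)%N ->
  (forall k, B k -> C (k %/ p)%N) -> ~~ (B (p * n)%N && B (p * n).+1) ->
  (count B (iota (p * n) p) <= C n * p.-1)%N.
Proof.
move=> p1 BC notB; have := count_block B C p n BC.
case: (C n) => //; rewrite !mul1n => _.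
case: p p1 notB {BC} => [|[|p]] // _; set s := (_ * n)%N => notB /=.
have := count_size B (iota s.+2 p); rewrite size_iota.
by move: notB; case: (B s); case: (B s.+1) => //= _; lia.
Qed.

(** Asymptotic density zero.  The tolerance is 1/q with q a natural number, so
    that the counting arguments stay within natural numbers. *)
Definition negligible (B : pred nat) : Prop :=
  forall q : nat, exists N0 : nat,
    forall N, (N0 <= N)%N -> (q * count_below B N <= N)%N.

Lemma negligible_sub (B C : pred nat) :
  (forall n, B n -> C n) -> negligible C -> negligible B.
Proof.
move=> BC nC q; have [N0 H] := nC q; exists N0 => N /H; apply: leq_trans.
by rewrite leq_mul2l sub_count ?orbT.
Qed.

Lemma negligibleU (B C : pred nat) :
  negligible B -> negligible C -> negligible (predU B C).
Proof.
move=> nB nC q; have [N1 H1] := nB (2 * q)%N; have [N2 H2] := nC (2 * q)%N.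
exists (maxn N1 N2) => N; rewrite geq_max => /andP[/H1 {}H1 /H2 {}H2].
have := count_predUI B C (iota 0 N); move: H1 H2; rewrite /count_below.
by nia.
Qed.

Lemma negligible_has (I : eqType) (s : seq I) (B : I -> pred nat) :
  (forall i, i \in s -> negligible (B i)) ->
  negligible (fun n => has (fun i => B i n) s).
Proof.
elim: s => [|i s IHs] nB.
  by move=> q; exists 0%N => N _; rewrite /count_below /= count_pred0 muln0.
apply: (negligible_sub _ (predU (B i) (fun n => has (fun j => B j n) s))) => //.
apply: negligibleU; first by apply: nB; rewrite mem_head.
by apply: IHs => j js; apply: nB; rewrite in_cons js orbT.
Qed.

(** It is enough to count up to the multiples of one length L, which may depend
    on q: rounding N up to a multiple of L adds at most L, and this is at most
    N once N >= L.  The factor 2 lost here is absorbed by applying the hypothesis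
    to 2 q. *)
Lemma negligible_block (B : pred nat) :
  (forall q : nat, exists2 L, (0 < L)%N &
     forall M, (q * count_below B (L * M) <= L * M)%N) ->
  negligible B.
Proof.
move=> HB q; have [L L0 HL] := HB (2 * q)%N; exists L => N LN.
have := HL (N %/ L).+1.
have N1 : (N <= L * (N %/ L).+1)%N by rewrite mulnC ltnW// ltn_ceil.
have N2 : (L * (N %/ L).+1 <= N + L)%N.
  by rewrite mulnS addnC leq_add2r mulnC leq_divM.
have := count_below_mono B _ _ N1.
by nia.
Qed.

Lemma negligible_div (B C : pred nat) p : (0 < p)%N ->
  (forall n, B n -> C (n %/ p)%N) -> negligible C -> negligible B.
Proof.
move=> p0 BC nC; apply: negligible_block => q.
have [N0 HN] := nC q.
exists (p * N0.+1)%N => [|M]; first by rewrite muln_gt0 p0.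
case: M => [|M]; first by rewrite muln0 /count_below muln0.
(* The blocks cover the integers below p * (N0.+1 * M.+1), and N0.+1 * M.+1 is
   large enough for the hypothesis on C. *)
have NM : (N0 <= N0.+1 * M.+1)%N by nia.
have := count_below_blocks B C p p (N0.+1 * M.+1)
  (fun n => count_block B C p n BC).
have := HN _ NM; rewrite -mulnA; set N := (N0.+1 * _)%N; nia.
Qed.

(** Bernoulli's inequality for (1 + 1/x) ^ k, cleared of denominators. *)
Lemma bernoulli_nat x k : (0 < x)%N -> (x ^ k * (x + k) <= x.+1 ^ k * x)%N.
Proof.
move=> x0; elim: k => [|k IHk]; first by rewrite addn0.
rewrite !expnS; move: IHk; set u := (x ^ k)%N; set v := (x.+1 ^ k)%N => IHk.
apply: (@leq_trans (x.+1 * (u * (x + k)))%N);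
  last by rewrite -mulnA leq_mul2l IHk orbT.
by nia.
Qed.

Lemma geometric_small p q : (1 < p)%N -> exists k, (q * p.-1 ^ k <= p ^ k)%N.
Proof.
case: p => [|[|p]] // _ /=.
(* With x := p.+1, this exponent k turns x + k into x * q.+1. *)
exists (q * p.+1)%N.
have := bernoulli_nat p.+1 (q * p.+1) isT.
set u := (p.+1 ^ _)%N; set v := (p.+2 ^ _)%N => H.
have : (u * (p.+1 + q * p.+1) = u * q.+1 * p.+1)%N by rewrite -mulnA mulSn.
by move=> E; move: H; rewrite E leq_pmul2r// => /(leq_trans _) -> //; nia.
Qed.

(** * Density of the exceptional sets *)

(** The quotient by p of an element lies in the set, and above each quotient one
    of the p candidates p n + r is missing.  So passing from M to p M multiplies
    the count by at most p - 1; after k passages the proportion is at most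
    (1 - 1/p) ^ k. *)
Lemma negligible_harmonic_val_gt0 p : prime p ->
  negligible (harmonic_val_gt p 0).
Proof.
move=> pp; have p0 := prime_gt0 pp; apply: negligible_block => q.
have [k qk] := geometric_small p q (prime_gt1 pp).
exists (p ^ k)%N => [|M]; first by rewrite expn_gt0 p0.
have ck : (count_below (harmonic_val_gt p 0) (p ^ k * M) <= p.-1 ^ k * M)%N.
  elim: k {qk} => [|k IHk]; first by rewrite !mul1n count_below_le.
  rewrite !expnS -!mulnA; apply: leq_trans (leq_mul (leqnn _) IHk).
  apply: count_below_blocks => n.
  apply: count_block_omit (prime_gt1 pp)
    (fun k => @harmonic_val_gt0_div p k pp) _.
  by rewrite negb_and -implybE; apply/implyP/harmonic_val_gt0_consecutive.
apply: leq_trans (leq_mul (leqnn q) ck) _.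
by rewrite mulnA leq_mul2r qk orbT.
Qed.

Lemma negligible_harmonic_val_gt p a : prime p ->
  negligible (harmonic_val_gt p a).
Proof.
move=> pp; have p0 := prime_gt0 pp.
elim: a => [|a IHa]; first exact: negligible_harmonic_val_gt0.
apply: (negligible_div _ _ p) IHa => // n; exact: harmonic_val_gt_div.
Qed.

(** * From the counting bounds to the limit *)

Lemma counting_function_truncn (R : realType) (A : set nat) (x : R) : 0 <= x ->
  counting_function A x = count (fun n => `[< A n >]) (iota 1 (Num.truncn x)).
Proof.
move=> x0; set s := [seq n <- iota 1 (Num.truncn x) | `[< A n >]].
have -> : counting_function A x = #|` [fset n in s]%fset|.
  congr (#|` _|); rewrite -[RHS]set_fsetK; congr (fset_set _).
  apply/seteqP; split=> n /=; rewrite !inE mem_filter mem_iota add1n ltnS.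
    by move=> [n1 nx An]; rewrite n1 truncn_ge_nat// nx !andbT; apply/asboolP.
  by move=> /andP[/asboolP An /andP[n1]]; rewrite truncn_ge_nat.
by rewrite card_fseq undup_id ?size_filter// filter_uniq// iota_uniq.
Qed.

(** With n the integer part of x, the number of elements of A up to x is at most
    x and, up to a bounded error, at least n - n / q. *)
Lemma density1_negligible (R : realType) (A : set nat) (B : pred nat) :
  (forall n, ~ A n -> B n) -> negligible B -> has_asymptotic_density A (1 : R).
Proof.
move=> AB nB; apply/cvgrPdist_le => e e0.
have [q qe] : exists q : nat, 2 <= q%:R * e.
  exists (Num.truncn (2 / e)).+1; rewrite -ler_pdivrMr// ltW//.
  by rewrite truncnS_gt.
have q0 : (0 < q%:R :> R) by rewrite -(pmulr_lgt0 _ e0); apply: lt_le_trans qe.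
have [N0 HN] := nB q.
near=> x.
have x1 : 1 <= x by near: x; apply: nbhs_pinfty_ge.
have x0 : 0 <= x by apply: le_trans x1.
have xe : 4 <= x * e.
  rewrite -ler_pdivrMr//; near: x; apply: nbhs_pinfty_ge.
have xN : N0%:R <= x by near: x; apply: nbhs_pinfty_ge.
rewrite counting_function_truncn//.
have /andP[] := truncn_itv x0.
have Nn : (N0 <= Num.truncn x)%N by rewrite truncn_ge_nat.
set n := Num.truncn x in Nn * => nx xn; set c := count _ _.
have cn : (c <= n)%N by rewrite -[leqRHS](size_iota 1); exact: count_size.
have cB : (n <= c + count_below B n.+1)%N.
  rewrite -[leqLHS](size_iota 1) -(count_predC (fun n => `[< A n >])) leq_add2l.
  rewrite /count_below /= (leq_trans _ (leq_addl _ _))// sub_count// => k /=.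
  by move=> /asboolPn; exact: AB.
have qB := HN n.+1 (leqW Nn).
move: cn cB qB; rewrite -(ler_nat R) -(ler_nat R n) -(ler_nat R (_ * _)).
rewrite natrM natrD -natr1; move: (count_below _ _)%:R => b.
rewrite -natr1 in xn; move: xn nx; move: n%:R c%:R => n' c' xn nx cn cB qB.
have xp : 0 < x by apply: lt_le_trans x1.
rewrite ger0_norm; last by rewrite subr_ge0 ler_pdivrMr// mul1r (le_trans cn).
rewrite lerBlDr -lerBlDl ler_pdivlMr// mulrBl mul1r (mulrC e).
rewrite -(ler_pM2l q0).
have q1 : 1 <= q%:R :> R by rewrite ler1n -(ltr0n R).
(* The deficit x - c' is at most 1 + b, hence q times it is at most q + x + 1;
   half of q * (x * e) pays for the term x and the other half for q + 1. *)
have h1 : q%:R * (x - c') <= q%:R * (1 + b) by rewrite ler_pM2l//; lra.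
have h2 : q%:R * 4 <= q%:R * (x * e) by rewrite ler_pM2l.
have h3 : 2 * x <= q%:R * e * x by rewrite ler_pM2r.
by lra.
Unshelve. all: by end_near. Qed.

Theorem corollary1p3 (R : realType) (m : nat) (hm : (0 < m)%N) :
  has_asymptotic_density [set n : nat | (m%:Z %| harmonic_den n)%Z] (1 : R).
Proof.
apply: (density1_negligible _ _
  (fun n => has (fun p => harmonic_val_gt p (logn p m) n) (primes m))).
- move=> n /= /negP; rewrite dvdzE /= => ndvd.
  apply: contraR ndvd => /hasPn low; apply/dvdn_partP => // p pm.
  rewrite p_part; apply: contraR (low p pm); apply: not_dvd_harmonic_den.
  by move: pm; rewrite mem_primes => /andP[].
- apply: negligible_has => p; rewrite mem_primes => /andP[pp _].
  exact: negligible_harmonic_val_gt.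
Qed.
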